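(* Let $M$ be a $C^k$-Fréchet manifold ($k\ge4$), let $\mathcal S$ be a spray on $M$ of class at least $C^2$, let $S\subset M$ be a non-empty closed subset that is spray-invariant with respect to $\mathcal S$, and let $\phi\in\mathrm{Aut}(M,\mathcal S)$. Then $\phi(S)$ is spray-invariant with respect to $\mathcal S$.
   Context: Manifolds are Hausdorff. $M$ is modeled on a real Fréchet space $F$ whose topology is given by a countable family of continuous seminorms $\|\cdot\|_n$, $n\in\mathbb N$; for $x\in F$, $B\subset F$ put $d_n(x,B)=\inf_{y\in B}\|x-y\|_n$. $C^k$ is understood in the Michal–Bastiani sense (continuous, with jointly continuous iterated directional derivatives up to order $k$). $\tau\colon TM\to M$ and $\tau_2\colon T(TM)\to TM$ are the tangent bundles; for a map $f$, $f_*=Tf$ and $f_{**}=T(Tf)$. Spray: a $C^r$-map $\mathcal S\colon TM\to T(TM)$ ($r\le k-2$) with $\tau_*\circ\mathcal S=\mathrm{Id}_{TM}$, $\tau_2\circ\mathcal S=\mathrm{Id}_{TM}$ and $\mathcal S(sv)=(L_s)_*(s\,\mathcal S(v))$ for all $s\in\mathbb R$, $v\in TM$, where $L_s(v)=sv$. A geodesic of $\mathcal S$ is a curve $g\colon I\to M$ whose canonical lift $g'$ is an integral curve of $\mathcal S$, i.e. $g''=\mathcal S(g')$. $\mathrm{Aut}(M,\mathcal S)$ is the group of $C^k$-automorphisms ($C^k$-diffeomorphisms) $\phi\colon M\to M$ with $\phi_{**}\circ\mathcal S\circ\phi_*^{-1}=\mathcal S$. Adjacent cone: for $S\subset M$,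 $s\in S$, the set $T_sS$ consists of all $v\in T_sM$ such that for some chart $(U,\varphi)$ around $s$, $\lim_{t\to0^+}t^{-1}d_n(\varphi(s)+t\,D\varphi(s)(v),\varphi(U\cap S))=0$ for all $n$. Second-order adjacent tangent vectors: for $s\in S$ and $v\in T_sS$, a vector $w\in T_v(TM)$ belongs to $T^2_sS$ (with associated vector $v$) if for some chart $(U,\varphi)$ about $s$, writing $v_\varphi=D\varphi(s)(v)$ and $(w_1,w_2)\in F\times F$ for the local representation of $w$ in the chart $T\varphi$ of $TM$, one has (i) $w_1=v_\varphi$ and (ii) $\lim_{t\to0^+}t^{-2}d_n(\varphi(s)+tv_\varphi+\tfrac12t^2w_2,\varphi(U\cap S))=0$ for all $n$. Admissible set: $A_{\mathcal S,S}=\{v\in TM : \tau(v)\in S \text{ and } \mathcal S(v)\in T^2_{\tau(v)}S\}$. Spray-invariance: a subset $S\subset M$ with $A_{\mathcal S,S}\neq\emptyset$ is spray-invariant with respect to $\mathcal S$ if for every geodesic $g\colon I\to M$ of $\mathcal S$ with $0\in I$, $g(0)\in S$ and $g'(0)\in A_{\mathcal S,S}$, one has $g(t)\in S$ for all $t\in I$. *)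

(* Defs.v *)
From HB Require Import structures.
From mathcomp Require Import all_boot all_order all_algebra.
From mathcomp Require Import all_classical reals topology normedtype.

Set Implicit Arguments.
Unset Strict Implicit.
Unset Printing Implicit Defensive.

Import Order.TTheory GRing.Theory Num.Theory.
Import numFieldNormedType.Exports.

Local Open Scope classical_set_scope.
Local Open Scope ring_scope.

(* For a metrizable topological vector space, completeness is sequential
   completeness.  The family of seminorms need not be increasing. *)
Structure frechetSpace (R : realType) := FrechetSpace {
  frechet_sort :> tvsType R;
  snorm : nat -> frechet_sort -> R;
  snormD : forall n x y, snorm n (x + y) <= snorm n x + snorm n y;
  snormZ : forall n (a : R) x, snorm n (a *: x) = `|a| * snorm n x;
  nbhs_snorm : forall (x : frechet_sort) (A : set frechet_sort),
    nbhs x A <-> exists (m : nat) (e : R), 0 < e /\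
      [set y | forall n, (n <= m)%N -> snorm n (y - x) < e] `<=` A;
  frechet_hausdorff : hausdorff_space frechet_sort;
  frechet_complete : forall u : nat -> frechet_sort,
    (forall n (e : R), 0 < e -> exists N : nat, forall i j : nat,
       (N <= i)%N -> (N <= j)%N -> snorm n (u i - u j) < e) ->
    exists l : frechet_sort, u @ \oo --> l
}.

(* The infimum is 0 for empty B; below, B always contains a point c(s). *)
Definition snorm_dist (R : realType) (F : frechetSpace R) (n : nat) (x : F)
  (B : set F) : R := inf [set snorm n (x - y) | y in B].

(* Differentiability classes: [Some k] is C^k and [None] is C^oo. *)
Definition smoothness := option nat.

Definition le_smoothness (j : nat) (k : smoothness) : bool :=
  if k is Some k' then (j <= k')%N else true.

Section MichalBastiani.
Variables (R : realType) (E G : tvsType R).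
Implicit Types (f : E -> G) (a v : E) (U : set E).

(* The library's [derive] is restricted to normed modules. *)
Definition dquot f a v (h : R) : G := h^-1 *: (f (a + h *: v) - f a).

Definition dirderivable f a v : Prop :=
  exists l : G, dquot f a v @ 0^' --> l.

Definition dirderiv f a v : G :=
  xget 0 [set l : G | dquot f a v @ 0^' --> l].

Fixpoint iter_dirderiv f (vs : seq E) : E -> G :=
  if vs is v :: vs' then fun a => dirderiv (iter_dirderiv f vs') a v else f.

Definition CkOn (k : smoothness) U f : Prop :=
  open U /\ forall j, le_smoothness j k ->
    (forall (vs : seq E) v a, (size vs).+1 = j -> U a ->
       dirderivable (iter_dirderiv f vs) a v) /\
    (forall p : E * 'rV[E]_j, U p.1 ->
       {for p, continuous (fun q : E * 'rV[E]_j =>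
          iter_dirderiv f [seq q.2 0 i | i <- enum 'I_j] q.1)}).

End MichalBastiani.

Record chart (X : Type) (E : Type) := Chart {
  cdom : set X;
  cmap :> X -> E    (* only meaningful on [cdom] *)
}.

Structure chartedSpace (R : realType) (E : tvsType R) := ChartedSpace {
  carrier :> topologicalType;
  atlas : set (chart carrier E);
  atlas_cover : forall x, exists2 c, atlas c & cdom c x
}.
Arguments atlas {R E} M : rename.

Section LocalRepresentatives.
Variables (R : realType) (E G : tvsType R) (X Y : Type).

(* [locrep c d f] is d o f o c^-1, defined on [locdom c d A f] =
   c(A /\ dom c /\ f^-1(dom d)) (and 0 outside of [locdom c d setT f]). *)
Definition locdom (c : chart X E) (d : chart Y G) (A : set X) (f : X -> Y) :
    set E :=
  [set c x | x in [set x | [/\ A x, cdom c x & cdom d (f x)]]].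

Definition locrep (c : chart X E) (d : chart Y G) (f : X -> Y) : E -> G :=
  fun y => xget 0 [set d (f x) | x in
                    [set x | [/\ cdom c x, cdom d (f x) & c x = y]]].

End LocalRepresentatives.

Section Manifolds.
Variables (R : realType) (E : tvsType R).

Definition homeo_chart (X : topologicalType) (c : chart X E) : Prop :=
  [/\ open (cdom c), set_inj (cdom c) c,
      forall x, cdom c x -> {for x, continuous c} &
      forall A : set X, A `<=` cdom c -> open A -> open (c @` A)].

Definition Ck_compatible (k : smoothness) (X : Type) (c d : chart X E) : Prop :=
  CkOn k (locdom c d setT id) (locrep c d id) /\
  CkOn k (locdom d c setT id) (locrep d c id).

(* The atlas is maximal: "a chart of M" is an element of [atlas M]. *)
Definition Ck_manifold (k : smoothness) (M : chartedSpace E) : Prop :=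
  [/\ hausdorff_space M,
      forall c, atlas M c -> homeo_chart c,
      forall c d, atlas M c -> atlas M d -> Ck_compatible k c d &
      forall c, homeo_chart c ->
        (forall d, atlas M d -> Ck_compatible k c d) -> atlas M c].

Definition chart_at (M : chartedSpace E) (x : M) : chart M E :=
  projT1 (cid2 (atlas_cover x)).

End Manifolds.

(* A is meant to be open.  Where f is continuous, testing all pairs of charts
   of the atlases is equivalent to testing one pair around each point. *)
Definition Ck_map_on (R : realType) (E G : tvsType R) (M : chartedSpace E)
    (N : chartedSpace G) (k : smoothness) (A : set M) (f : M -> N) : Prop :=
  (forall x, A x -> {for x, continuous f}) /\
  forall c d, atlas M c -> atlas N d ->
    CkOn k (locdom c d A f) (locrep c d f).

Definition Ck_map (R : realType) (E G : tvsType R) (M : chartedSpace E)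
    (N : chartedSpace G) (k : smoothness) (f : M -> N) : Prop :=
  Ck_map_on k setT f.

Section TangentBundle.
Variables (R : realType) (E : tvsType R) (M : chartedSpace E).

(* The class of (c, e), where c is a chart around x: all pairs (d, e') such
   that d is a chart around x and e' = D(d o c^-1)(c x) e. *)
Definition tclass (x : M) (c : chart M E) (e : E) : set (chart M E * E) :=
  [set p | [/\ atlas M p.1, cdom p.1 x &
               p.2 = dirderiv (locrep c p.1 id) (c x) e]].

Record tangent := Tangent {
  tbase : M;
  tvalue : set (chart M E * E);
  tvalueP : exists c e,
    [/\ atlas M c, cdom c tbase & tvalue = tclass tbase c e]
}.

(* D c (x) (v), for v tangent at x and c a chart around x *)
Definition trep (c : chart M E) (v : tangent) : E :=
  xget 0 [set e | tvalue v (c, e)].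

Lemma tvec_subproof (x : M) (e : E) : exists c e',
  [/\ atlas M c, cdom c x & tclass x (chart_at x) e = tclass x c e'].
Proof.
exists (chart_at x), e; rewrite /chart_at.
by case: (cid2 (atlas_cover x)) => c /= Mc cx; split.
Qed.

(* The vector at x represented by e in the chart [chart_at x] *)
Definition tvec (x : M) (e : E) : tangent := Tangent (tvec_subproof x e).

(* T c, with values in E * E *)
Definition tchart (c : chart M E) : chart tangent (E * E)%type :=
  Chart [set v | cdom c (tbase v)] (fun v => (c (tbase v), trep c v)).

HB.instance Definition _ := gen_eqMixin tangent.
HB.instance Definition _ := gen_choiceMixin tangent.

(* The topology determined by the charts T c: A is open when, for every chart
   c, the image under T c of the part of A over [cdom c] is open in the image
   of T c. *)
Definition topen (A : set tangent) : Prop :=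
  forall c, atlas M c -> forall v, A v -> cdom (tchart c) v ->
    \forall p \near tchart c v,
      forall u, cdom (tchart c) u -> tchart c u = p -> A u.

Lemma topenT : topen setT.
Proof. by move=> c _ v _ _; apply: filterE => p u _ _. Qed.

Lemma topenI : setI_closed topen.
Proof.
move=> A B oA oB c Mc v [Av Bv] cv.
apply: filterS2 (oA c Mc v Av cv) (oB c Mc v Bv cv) => p pA pB u cu up.
by split; [exact: pA|exact: pB].
Qed.

Lemma topen_bigU (I : Type) (f : I -> set tangent) :
  (forall i, topen (f i)) -> topen (\bigcup_i f i).
Proof.
move=> of_ c Mc v [i _ fiv] cv.
apply: filterS (of_ i c Mc v fiv cv) => p pf u cu up.
by exists i => //; exact: pf.
Qed.

HB.instance Definition _ := isOpenTopological.Build tangent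
  topenT topenI topen_bigU.

Lemma tbundle_subproof (v : tangent) :
  exists2 c, (tchart @` atlas M) c & cdom c v.
Proof.
by have [c Mc cx] := atlas_cover (tbase v); exists (tchart c) => //; exists c.
Qed.

Definition tbundle : chartedSpace (E * E)%type :=
  ChartedSpace tbundle_subproof.

Definition tscale (s : R) (v : tbundle) : tbundle :=
  tvec (tbase v) (s *: trep (chart_at (tbase v)) v).

Definition tproj (v : tbundle) : M := tbase v.

End TangentBundle.

(* f_*.  For f of class C^1 the result does not depend on the chosen charts. *)
Definition tmap (R : realType) (E G : tvsType R) (M : chartedSpace E)
    (N : chartedSpace G) (f : M -> N) (v : tbundle M) : tbundle N :=
  let x := tproj v in
  let c := chart_at x in
  tvec (f x) (dirderiv (locrep c (chart_at (f x)) f) (c x) (trep c v)).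

Section Curves.
Variable R : realType.

Lemma line_subproof (x : R^o) :
  exists2 c, [set Chart setT (id : R^o -> R^o)] c & cdom c x.
Proof. by exists (Chart setT id). Qed.

Definition line : chartedSpace R^o := ChartedSpace line_subproof.

Variables (E : tvsType R) (M : chartedSpace E).

(* Canonical lift: g'(t) = T_t g (1) *)
Definition clift (g : line -> M) (t : line) : tbundle M :=
  tmap g (@tvec R R^o line t 1).

Definition integral_curve (X : M -> tbundle M) (I : set R) (g : line -> M) :
    Prop :=
  Ck_map_on (Some 1%N) (I : set line) g /\
  forall t, I t -> clift g t = X (g t).

End Curves.

Section Sprays.
Variables (R : realType) (E : tvsType R) (M : chartedSpace E).
Local Notation TM := (tbundle M).
Local Notation TTM := (tbundle TM).

Definition spray (r : nat) (S : TM -> TTM) : Prop :=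
  [/\ Ck_map (Some r) S,
      tmap (@tproj R E M) \o S = id,
      @tproj R _ TM \o S = id &
      forall (s : R) (v : TM), S (tscale s v) = tmap (tscale s) (tscale s (S v))].

(* I is meant to be an open interval; the values of g outside of I are
   irrelevant. *)
Definition geodesic (S : TM -> TTM) (I : set R) (g : R -> M) : Prop :=
  Ck_map_on (Some 1%N) (I : set (line R)) (g : line R -> M) /\
  integral_curve S I (clift g).

Definition Ck_diffeo (k : smoothness) (phi : M -> M) : Prop :=
  Ck_map k phi /\
  exists psi : M -> M, [/\ cancel phi psi, cancel psi phi & Ck_map k psi].

Definition spray_automorphism (k : smoothness) (S : TM -> TTM)
    (phi : M -> M) : Prop :=
  Ck_diffeo k phi /\
  exists phi_inv : TM -> TM,   (* the inverse of phi_* *)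
    [/\ cancel (tmap phi) phi_inv, cancel phi_inv (tmap phi) &
        tmap (tmap phi) \o S \o phi_inv = S].

End Sprays.

Section SprayInvariance.
Variables (R : realType) (F : frechetSpace R) (M : chartedSpace F).
Local Notation TM := (tbundle M).
Local Notation TTM := (tbundle TM).

Definition adjacent_cone (S : set M) (s : M) : set TM :=
  [set v | tproj v = s /\ exists c, [/\ atlas M c, cdom c s &
     forall n, (fun t : R => t^-1 *
         snorm_dist n (c s + t *: trep c v) (c @` (cdom c `&` S)))
       @ 0^'+ --> (0 : R)]].

Definition adjacent_cone2 (S : set M) (s : M) : set TTM :=
  [set w | let v := tproj w in
     adjacent_cone S s v /\ exists c, [/\ atlas M c, cdom c s,
       (trep (M := TM) (tchart c) w).1 = trep c v &
       forall n, (fun t : R => (t ^+ 2)^-1 *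
           snorm_dist n (c s + t *: trep c v
                         + (2^-1 * t ^+ 2) *: (trep (M := TM) (tchart c) w).2)
                        (c @` (cdom c `&` S)))
         @ 0^'+ --> (0 : R)]].

Definition admissible (Sp : TM -> TTM) (S : set M) : set TM :=
  [set v | S (tproj v) /\ adjacent_cone2 S (tproj v) (Sp v)].

Definition spray_invariant (Sp : TM -> TTM) (S : set M) : Prop :=
  admissible Sp S !=set0 /\
  forall (I : set R) (g : R -> M),
    open I -> is_interval I -> I 0 ->
    geodesic Sp I g -> S (g 0) -> admissible Sp S (clift (g : line R -> M) 0) ->
    forall t, I t -> S (g t).

End SprayInvariance.

(* Main.v *)
(* A diffeomorphism phi with inverse psi permutes the charts of a maximal
   atlas by c |-> c o psi.  In the charts c at s and c o psi at phi(s), the sets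
   S and phi(S) have the same image, and v and phi_* v, as well as w and
   phi_** w, have the same local representation.  Adjacent cones of both orders,
   hence the admissible sets of an automorphism of the spray, are therefore
   transported by phi without any Taylor expansion, and so are geodesics; the
   claim for phi(S) follows from the claim for S by composing geodesics with
   psi.

   The calculus needed is the independence of tangent vectors and tangent maps
   of the charts, on M and on TM: the chain rule for C^1 maps, and the fact that
   (x, v) |-> (f x, df(x) v) is C^1 when f is C^2.  Both follow from the mean
   value inequality for seminorms. *)

Require Import Defs.
From HB Require Import structures.
From mathcomp Require Import all_boot all_order all_algebra.
From mathcomp Require Import all_classical reals topology normedtype.
From mathcomp Require Import lra.

Set Implicit Arguments.
Unset Strict Implicit.
Unset Printing Implicit Defensive.

Import Order.TTheory GRing.Theory Num.Theory.
Import numFieldNormedType.Exports.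

Local Open Scope classical_set_scope.
Local Open Scope ring_scope.

(** * Seminorms *)

(** The supremum of the [s] with [d 0 s <= K * s] satisfies the bound itself, and the local estimate
    there pushes the bound further right unless the supremum is 1. Since [d] may be asymmetric, the
    local bound is asked in both orders. *)
Lemma local_lipschitz_le (R : realType) (d : R -> R -> R) (K : R) :
  (forall s m r, d s r <= d s m + d m r) ->
  (forall s : R, 0 <= s <= 1 -> exists2 e : R, 0 < e &
     forall r : R, 0 <= r <= 1 ->
     `|r - s| < e -> d s r <= K * `|r - s| /\ d r s <= K * `|r - s|) ->
  d 0 1 <= K.
Proof.
move=> tri loc.
pose A := [set s : R | 0 <= s <= 1 /\ d 0 s <= K * s].
have A0 : A 0.
  have [|e e0 /(_ 0)] := loc 0; first by rewrite lexx ler01.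
  rewrite lexx ler01 subrr normr0 mulr0 => /(_ isT e0)[d0 _].
  by split; rewrite ?lexx ?ler01 ?mulr0.
have hA : has_sup A.
  by split; [exists 0|exists 1 => s [/andP[]]].
have m01 : 0 <= sup A <= 1.
  apply/andP; split; first by apply: ub_le_sup => //; case: hA.
  by apply: ge_sup; [exists 0|move=> s [/andP[]]].
have [e e0 le_d] := loc _ m01.
have [s [s01 ds] sm] := sup_adherent e0 hA.
have sle : s <= sup A by apply: ub_le_sup; [case: hA|split].
have Am : d 0 (sup A) <= K * sup A.
  have [|_] := le_d s s01; first by rewrite ler0_norm ?subr_le0//; lra.
  rewrite ler0_norm ?subr_le0//; have := tri 0 s (sup A).
  by rewrite opprB mulrBr => H1 H2; lra.
have [m1|m1] := ltP (sup A) 1; last first.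
  have mE : sup A = 1 by apply/eqP; rewrite eq_le m1 andbT; case/andP: m01.
  by rewrite mE mulr1 in Am.
pose r := Num.min 1 (sup A + e / 2).
have mr : sup A < r by rewrite lt_min m1/= ltrDl divr_gt0.
have r01 : 0 <= r <= 1 by rewrite ge_min lexx/= andbT; lra.
have rm : r <= sup A + e / 2 by rewrite ge_min lexx orbT.
have Ar : A r.
  split=> //; have [|H _] := le_d r r01; first by rewrite gtr0_norm; lra.
  have := tri 0 (sup A) r; rewrite gtr0_norm ?subr_gt0// in H.
  by rewrite mulrBr in H; move=> H2; lra.
by have := ub_le_sup hA.2 Ar; rewrite leNgt mr.
Qed.

Section Seminorms.
Variable R : realType.

Definition cont_seminorm (E : tvsType R) (p : E -> R) : Prop :=
  [/\ forall x y, p (x + y) <= p x + p y,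
      forall a x, p (a *: x) = `|a| * p x &
      forall e, 0 < e -> \forall x \near (0 : E), p x < e].

(** Local convexity, in a form that passes from the model space [E] to [E * E], the model of the
    tangent bundle. *)
Definition seminormable (E : tvsType R) : Prop :=
  forall A : set E, nbhs 0 A ->
    exists2 p : E -> R, cont_seminorm p & [set x | p x < 1] `<=` A.

Section Theory.
Variables (E : tvsType R) (p : E -> R).
Hypothesis hp : cont_seminorm p.

Lemma cont_seminorm0 : p 0 = 0.
Proof. by case: hp => _ pZ _; rewrite -(scale0r 0) pZ normr0 mul0r. Qed.

Lemma cont_seminormN x : p (- x) = p x.
Proof. by case: hp => _ pZ _; rewrite -scaleN1r pZ normrN1 mul1r. Qed.

Lemma cont_seminormB x y z : p (x - z) <= p (x - y) + p (y - z).
Proof. by case: hp => pD _ _; rewrite (le_trans _ (pD _ _))// addrA subrK. Qed.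

Lemma near_cont_seminorm x e : 0 < e -> \forall y \near x, p (y - x) < e.
Proof.
case: hp => _ _ pc e0.
have : (fun y : E => y - x) @ x --> (0 : E).
  rewrite -(subrr x).
  apply: (@continuous_comp _ _ _ (fun y : E => (y, x))
    (fun z : E * E => z.1 - z.2)).
    by apply: cvg_pair => /=; [exact: cvg_id|exact: cvg_cst].
  exact: sub_continuous.
by move=> /(_ _ (pc _ e0)).
Qed.

(** The point is the convex combination of [y] and [z] with weights [1 - s] and [s]. The mean value
    argument uses this to keep a segment inside a seminorm ball. *)
Lemma cont_seminorm_convex x y z s e : 0 <= s <= 1 ->
  p (y - x) < e -> p (z - x) < e -> p (y + s *: (z - y) - x) < e.
Proof.
move=> s01 py pz; case: hp => pD pZ _.
have -> : y + s *: (z - y) - x = (1 - s) *: (y - x) + s *: (z - x).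
  rewrite addrAC scalerBl scale1r -[RHS]addrA; congr (_ + _).
  by rewrite [RHS]addrC -scalerBr opprB addrA subrK.
rewrite (le_lt_trans (pD _ _))// !pZ !ger0_norm; [|lra..].
have pm : Num.max (p (y - x)) (p (z - x)) < e by rewrite gt_max py.
have ym : p (y - x) <= Num.max (p (y - x)) (p (z - x)) by rewrite le_max lexx.
have zm : p (z - x) <= Num.max (p (y - x)) (p (z - x)).
  by rewrite le_max lexx orbT.
by nra.
Qed.

End Theory.

Lemma nbhs_cont_seminorm (E : tvsType R) (x : E) (A : set E) :
  seminormable E -> nbhs x A ->
  exists2 p, cont_seminorm p & [set y | p (y - x) < 1] `<=` A.
Proof.
move=> hE xA; have : (fun y : E => y + x) @ 0 --> x.
  rewrite -[X in _ --> X]add0r.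
  apply: (@continuous_comp _ _ _ (fun y : E => (y, x))
    (fun z : E * E => z.1 + z.2)).
    by apply: cvg_pair => /=; [exact: cvg_id|exact: cvg_cst].
  exact: add_continuous.
move=> /(_ _ xA)/hE[p hp pA]; exists p => // y /pA.
by rewrite /= subrK.
Qed.

Lemma cvg_cont_seminorm (E : tvsType R) T (D : set_system T) {FD : Filter D}
    (f : T -> E) (l : E) : seminormable E ->
  (forall p, cont_seminorm p -> forall e, 0 < e ->
    \forall t \near D, p (f t - l) <= e) ->
  f @ D --> l.
Proof.
move=> hE H A /(nbhs_cont_seminorm hE)[p hp pA].
apply: filterS (H p hp (2^-1) _); last by rewrite invr_gt0.
by move=> t pt; apply: pA => /=; rewrite (le_lt_trans pt)// invf_lt1// ltr1n.
Qed.

(** The seminorm [p x + q y] dominates both summands, since [0 = p 0 <= p x + p (- x)] forces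
    nonnegativity. *)
Lemma seminormable_prod (E G : tvsType R) :
  seminormable E -> seminormable G -> seminormable (E * G)%type.
Proof.
move=> hE hG A [[B C]/= [/hE[p [pD pZ pc] pB] /hG[q [qD qZ qc] qC]] BCA].
have p0 x : 0 <= p x.
  have := pD x (- x); rewrite subrr (cont_seminorm0 (And3 pD pZ pc)).
  by rewrite (cont_seminormN (And3 pD pZ pc)); lra.
have q0 x : 0 <= q x.
  have := qD x (- x); rewrite subrr (cont_seminorm0 (And3 qD qZ qc)).
  by rewrite (cont_seminormN (And3 qD qZ qc)); lra.
exists (fun z => p z.1 + q z.2).
  split => [x y|a x|e e0].
  - by have := pD x.1 y.1; have := qD x.2 y.2 => /=; lra.
  - by rewrite pZ qZ mulrDr.
  - have e2 : 0 < e / 2 by rewrite divr_gt0.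
    exists ([set x | p x < e / 2], [set x | q x < e / 2]) => /=.
      by split; [exact: pc|exact: qc].
    by move=> x [/= ? ?]; rewrite /=; lra.
move=> x /= xlt; apply: BCA; split=> /=.
  by apply: pB => /=; have := q0 x.2; lra.
by apply: qC => /=; have := p0 x.1; lra.
Qed.

(** A basic neighbourhood involves only the seminorms of index at most [m]; their sum divided by [e]
    is one seminorm whose unit ball lies in it. *)
Lemma seminormable_frechet (F : frechetSpace R) : seminormable F.
Proof.
move=> A /nbhs_snorm[m [e [e0 eA]]].
have s0 n x : 0 <= snorm (f := F) n x.
  have := snormD n x (- x); rewrite subrr -[X in snorm n X](scale0r 0).
  by rewrite -(scaleN1r x) !snormZ normr0 mul0r normrN1; lra.
exists (fun x => e^-1 * \sum_(i < m.+1) snorm i x).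
  split => [x y|a x|d d0].
  - rewrite -mulrDr -big_split/= ler_wpM2l ?invr_ge0 ?(ltW e0)//.
    by apply: ler_sum => i _; exact: snormD.
  - rewrite [RHS]mulrCA; congr (_ * _).
    by rewrite mulr_sumr; apply: eq_bigr => i _; rewrite snormZ.
  - apply/nbhs_snorm; exists m, (e * d / m.+1%:R); split.
      by rewrite !mulr_gt0// invr_gt0 ltr0n.
    move=> y /= ylt; rewrite -ltr_pdivlMl ?invr_gt0// invrK.
    rewrite (@lt_le_trans _ _ (\sum_(i < m.+1) (e * d / m.+1%:R)))//.
      apply: ltr_sum => [|i _]; last first.
        by rewrite -[y]subr0; apply: ylt; rewrite -ltnS.
      by apply/hasP; exists ord0; rewrite ?mem_index_enum.
    by rewrite sumr_const card_ord -[leLHS]mulr_natr divfK ?pnatr_eq0.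
move=> x /= xlt; apply: eA => /= n nm; rewrite subr0.
rewrite (le_lt_trans _ (_ : \sum_(i < m.+1) snorm i x < e))//; last first.
  by move: xlt; rewrite mulrC ltr_pdivrMr// mul1r.
rewrite (bigD1 (inord n))//= inordK ?ltnS// lerDl.
exact: sumr_ge0.
Qed.

End Seminorms.

(** * Chain rule *)

Section TvsLimits.
Variables (R : realType) (E : tvsType R) (T : Type) (D : set_system T).
Context {FD : Filter D}.

Lemma tvs_cvgD (f g : T -> E) (a b : E) : f @ D --> a -> g @ D --> b ->
  (fun t => f t + g t) @ D --> a + b.
Proof.
move=> fa gb; apply: (@cvg_comp _ _ _ (fun t => (f t, g t))
  (fun z : E * E => z.1 + z.2)); last exact: (@add_continuous E (a, b)).
exact: cvg_pair.
Qed.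

Lemma tvs_cvgZ (k : T -> R) (f : T -> E) (c : R) (a : E) :
  k @ D --> c -> f @ D --> a ->
  (fun t => k t *: f t) @ D --> c *: a.
Proof.
move=> kc fa.
have kf : (fun t => (k t : R^o, f t)) @ D --> ((c : R^o), a).
  exact: (@cvg_pair _ _ _ D (nbhs (c : R^o)) (nbhs a) _ _ _ _ _ kc fa).
exact: cvg_comp kf (@scale_continuous R E (c, a)).
Qed.

End TvsLimits.

Section Derivatives.
Variables (R : realType) (E G : tvsType R).
Implicit Types (f h : E -> G) (x v w : E) (U : set E).

Definition C1_on U f : Prop :=
  [/\ open U, forall x v, U x -> dirderivable f x v &
      forall z : E * E, U z.1 ->
        {for z, continuous (fun z : E * E => dirderiv f z.1 z.2)}].

Lemma cvg_dirderiv f x v :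
  dirderivable f x v -> dquot f x v @ 0^' --> dirderiv f x v.
Proof. by move=> fxv; have := xgetPex 0 fxv. Qed.

Lemma dirderiv_unique f x v (l : G) : hausdorff_space G ->
  dquot f x v @ 0^' --> l -> dirderiv f x v = l.
Proof.
move=> hG fl; have /cvg_dirderiv fd : dirderivable f x v by exists l.
exact: (@cvg_unique _ hG _ _ _ _ fd fl).
Qed.

Lemma cvg_line x v : (fun t : R => x + t *: v) @ (0 : R) --> x.
Proof.
rewrite -[X in _ --> X]addr0 -[X in _ + X](scale0r v).
apply: tvs_cvgD; first exact: cvg_cst.
by apply: tvs_cvgZ; [exact: cvg_id|exact: cvg_cst].
Qed.

Lemma cvg_line_dnbhs x v : (fun t : R => x + t *: v) @ 0^' --> x.
Proof. by apply: cvg_within_filter; exact: cvg_line. Qed.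

Lemma dquot_near f h x v : (\forall y \near x, f y = h y) ->
  \forall t \near (0 : R), dquot f x v t = dquot h x v t.
Proof.
move=> fh; have fhx := nbhs_singleton fh.
have fhl : \forall t \near (0 : R), f (x + t *: v) = h (x + t *: v).
  exact: cvg_line fh.
by apply: filterS fhl => t fht; rewrite /dquot fht fhx.
Qed.

Lemma dquot_cvg_near f h x v (l : G) : (\forall y \near x, f y = h y) ->
  dquot f x v @ 0^' --> l -> dquot h x v @ 0^' --> l.
Proof.
move=> fh; apply: cvg_trans; apply: near_eq_cvg.
by apply: cvg_within; apply: filterS (dquot_near v fh) => t ->.
Qed.

Lemma dirderivable_near f h x v : (\forall y \near x, f y = h y) ->
  dirderivable f x v -> dirderivable h x v.
Proof. by move=> fh [l fl]; exists l; exact: dquot_cvg_near fl. Qed.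

(** Differentiability plays no part: both sides choose from the same set of limits, default value
    included. *)
Lemma dirderiv_near f h x v : (\forall y \near x, f y = h y) ->
  dirderiv f x v = dirderiv h x v.
Proof.
move=> fh; rewrite /dirderiv; congr xget; apply/seteqP; split=> l /=.
  exact: dquot_cvg_near.
by apply: dquot_cvg_near; apply: filterS fh => y ->.
Qed.

Lemma dirderivZ f x v a : hausdorff_space G -> dirderivable f x v ->
  dirderiv f x (a *: v) = a *: dirderiv f x v.
Proof.
move=> hG /cvg_dirderiv fxv; apply: dirderiv_unique => //.
(* For [a = 0] the substitution [t * a] would leave the punctured neighbourhood. *)
have [->|a0] := eqVneq a 0.
  rewrite !scale0r; have : (fun _ : R => (0 : G)) @ 0^' --> (0 : G).
    exact: cvg_cst.
  apply: cvg_trans; apply: near_eq_cvg; near=> t.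
  by rewrite /dquot scaler0 addr0 subrr scaler0.
have a_t : (fun t : R => t * a) @ 0^' --> 0^'.
  have : (fun t : R => t * a) @ (0 : R) --> (0 * a : R).
    by apply: cvgM; [exact: cvg_id|exact: cvg_cst].
  rewrite mul0r => ta.
  move=> A A0; change (nbhs (0 : R) [set t | t != 0 -> A (t * a)]).
  have H : \forall t \near (0 : R), t * a != 0 -> A (t * a) := ta _ A0.
  apply: filterS H => t At t0.
  by apply: At; rewrite mulf_neq0.
have : (fun t => a *: dquot f x v (t * a)) @ 0^' --> a *: dirderiv f x v.
  by apply: tvs_cvgZ; [exact: cvg_cst|exact: cvg_comp a_t fxv].
apply: cvg_trans; apply: near_eq_cvg; near=> t.
by rewrite /= /dquot !scalerA invfM mulrCA divff// mulr1.
Unshelve. all: by end_near. Qed.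

(* The mean value inequality on the segment [y, y + t u], along which the
   derivative in direction u is close to that at x in direction w. *)
Lemma C1_strict f U x w (p : G -> R) e :
  seminormable E -> cont_seminorm p -> 0 < e -> C1_on U f -> U x ->
  exists q1 q2 : E -> R, [/\ cont_seminorm q1, cont_seminorm q2 &
    forall y u t, t != 0 -> q1 (y - x) < 1 -> q1 (y + t *: u - x) < 1 ->
      q2 (u - w) < 1 ->
      p (t^-1 *: (f (y + t *: u) - f y) - dirderiv f x w) <= e].
Proof.
move=> hE hp e0 [oU fU cf] Ux; set l := dirderiv f x w.
have [[B C]/= [xB wC BC]] : nbhs (x, w) [set z : E * E | U z.1 /\
    p (dirderiv f z.1 z.2 - l) < e].
  apply: filterI.
    exists (U, setT) => /=; last by move=> z [].
    by split; [exact: open_nbhs_nbhs|exact: filterT].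
  have H : nbhs l [set c | p (c - l) < e] by exact: near_cont_seminorm.
  exact: (cf (x, w) Ux _ H).
have [q1 hq1 q1B] := nbhs_cont_seminorm hE xB.
have [q2 hq2 q2C] := nbhs_cont_seminorm hE wC.
exists q1, q2; split => // y u t t0 q1y q1z q2u.
(* Along the segment, [d] is the error of the linear approximation with slope [l]. It is
   subadditive, and the derivative at each point of the segment bounds it locally. *)
pose g s := f (y + (s * t) *: u).
pose d s r := p (g r - g s - ((r - s) * t) *: l).
have dC s r : d s r = d r s.
  rewrite /d -(cont_seminormN hp); congr p.
  by rewrite !opprB addrC -scaleNr -mulNr opprB.
have : d 0 1 <= `|t| * e.
  apply: local_lipschitz_le.
    move=> s m r; case: hp => pD _ _; rewrite addrC (le_trans _ (pD _ _))//.
    rewrite addrACA [_ + (g m - g s)]addrA subrK -opprD -scalerDl -mulrDl.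
    by rewrite addrA subrK.
  move=> s s01; pose z := y + (s * t) *: u.
  have Bz : B z.
    apply: q1B; rewrite /= /z -scalerA.
    have := cont_seminorm_convex hq1 s01 q1y q1z.
    by rewrite [y + t *: u]addrC addrK.
  have [/= Uz pz] := BC (z, u) (conj Bz (q2C _ q2u)).
  (* The strict bound on the derivative at [z] leaves room, so difference quotients with small step
     satisfy it too. *)
  have zl : nbhs (dirderiv f z u) [set c | p (c - l) < e].
    have b0 : 0 < e - p (dirderiv f z u - l) by rewrite subr_gt0.
    apply: filterS (near_cont_seminorm hp (dirderiv f z u) b0) => c pc /=.
    rewrite (le_lt_trans (cont_seminormB hp _ (dirderiv f z u) _))//.
    by move: pc; lra.
  have : \forall h \near (0 : R)^', p (dquot f z u h - l) < e.
    exact: (cvg_dirderiv (fU _ u Uz) zl).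
  move=> /nbhs_ballP[k /= k0 kP].
  (* With this radius the actual step [(r - s) * t] is smaller than [k] in absolute value. *)
  exists (k / `|t|); first by rewrite divr_gt0// normr_gt0.
  move=> r r01 rs; rewrite -[d r s]dC; suff: d s r <= `|t| * e * `|r - s| by [].
  have [->|rs0] := eqVneq r s.
    by rewrite /d !subrr mul0r scale0r subr0 (cont_seminorm0 hp) normr0 mulr0.
  have rt0 : (r - s) * t != 0 by rewrite mulf_neq0// subr_eq0.
  have : p (dquot f z u ((r - s) * t) - l) < e.
    apply: kP => //; rewrite /ball/= sub0r normrN normrM.
    by rewrite -ltr_pdivlMr ?normr_gt0.
  have zr : z + ((r - s) * t) *: u = y + (r * t) *: u.
    by rewrite /z -addrA -scalerDl -mulrDl [s + _]addrC subrK.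
  rewrite /dquot zr => /ltW.
  have -> : f (y + (r * t) *: u) - f z = g r - g s by [].
  move=> le_e.
  have -> : d s r = `|(r - s) * t| * p (((r - s) * t)^-1 *: (g r - g s) - l).
    case: hp => _ pZ _; rewrite -pZ scalerBr scalerA divff// scale1r.
    by rewrite /d.
  by rewrite normrM -[leLHS]mulrA [leRHS]mulrC ler_wpM2l // ler_wpM2l.
rewrite /d /g mul1r mul0r scale0r addr0 subr0 mul1r => le_te.
have tp : 0 < `|t| by rewrite normr_gt0.
rewrite -(ler_pM2l tp) (le_trans _ le_te)//; case: hp => _ pZ _.
by rewrite -pZ scalerBr scalerA divff// scale1r.
Qed.

(** Strict differentiability: base point, direction and step vary together. A moving base point
    gives additivity of the derivative, a moving direction the chain rule. *)
Lemma C1_cvg f U x w T (D : set_system T) {FD : Filter D} (y u : T -> E)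
    (t : T -> R) :
  seminormable E -> seminormable G -> C1_on U f -> U x ->
  y @ D --> x -> u @ D --> w -> t @ D --> 0 -> (\forall s \near D, t s != 0) ->
  (fun s => (t s)^-1 *: (f (y s + t s *: u s) - f (y s))) @ D -->
  dirderiv f x w.
Proof.
move=> hE hG fU Ux yx uw t0 tN0.
apply: cvg_cont_seminorm => // p hp e e0.
have [q1 [q2 [hq1 hq2 H]]] := C1_strict w hE hp e0 fU Ux.
have yux : (fun s => y s + t s *: u s) @ D --> x.
  rewrite -[X in _ --> X]addr0 -(scale0r w).
  by apply: tvs_cvgD => //; exact: tvs_cvgZ.
have N1 := yx _ (near_cont_seminorm hq1 x ltr01).
have N2 := yux _ (near_cont_seminorm hq1 x ltr01).
have N3 := uw _ (near_cont_seminorm hq2 w ltr01).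
near=> s; apply: H; near: s; [exact: tN0|exact: N1|exact: N2|exact: N3].
Unshelve. all: by end_near. Qed.

(** The increment along [t *: (v + w)] is split at [x + t *: v]; the second piece starts at a moving
    point and is handled by [C1_cvg]. *)
Lemma dirderivD f U x v w : hausdorff_space G ->
  seminormable E -> seminormable G -> C1_on U f -> U x ->
  dirderiv f x (v + w) = dirderiv f x v + dirderiv f x w.
Proof.
move=> HG hE hG fU Ux; rewrite [RHS]addrC; apply: dirderiv_unique => //.
have t0 : (fun t : R => t) @ 0^' --> (0 : R) by exact: cvg_within.
have tN0 : \forall t \near (0 : R)^', t != 0.
  by apply: (@withinT R).
have xv := @cvg_line_dnbhs x v.
have H1 : (fun t => t^-1 *: (f (x + t *: v + t *: w) - f (x + t *: v)))
    @ 0^' --> dirderiv f x w.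
  by apply: C1_cvg fU Ux _ _ _ _ => //; exact: cvg_cst.
have fxv : dirderivable f x v by case: fU => _ + _; apply.
have : (fun t => t^-1 *: (f (x + t *: v + t *: w) - f (x + t *: v))
    + dquot f x v t) @ 0^' --> dirderiv f x w + dirderiv f x v.
  by apply: tvs_cvgD => //; exact: cvg_dirderiv.
apply: cvg_trans; apply: near_eq_cvg.
near=> t; rewrite /dquot -scalerDr addrA subrK.
by rewrite (scalerDr t v w) addrA.
Unshelve. all: by end_near. Qed.

End Derivatives.

(** For [t != 0], [g (x + t *: v)] is [g x + t *: dquot g x v t], so the quotient of the composite
    is a quotient of [f] at [g x] in a converging direction. *)
Lemma C1_comp_cvg (R : realType) (E G H : tvsType R) (g : E -> G) (f : G -> H)
    (U : set G) x v :
  seminormable G -> seminormable H -> C1_on U f -> U (g x) ->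
  dirderivable g x v ->
  dquot (f \o g) x v @ 0^' --> dirderiv f (g x) (dirderiv g x v).
Proof.
move=> hG hH fU Ux gv.
have t0 : (fun t : R => t) @ 0^' --> (0 : R) by exact: cvg_within.
have tN0 : \forall t \near (0 : R)^', t != 0 by apply: (@withinT R).
have : (fun t => t^-1 *: (f (g x + t *: dquot g x v t) - f (g x))) @ 0^' -->
    dirderiv f (g x) (dirderiv g x v).
  by apply: C1_cvg fU Ux _ _ _ _ => //; [exact: cvg_cst|exact: cvg_dirderiv].
apply: cvg_trans; apply: near_eq_cvg; near=> t.
have tn : t != 0 by near: t.
by rewrite /dquot /= scalerA divff// scale1r [g x + _]addrC subrK.
Unshelve. all: by end_near. Qed.

Lemma hausdorff_prod (X Y : topologicalType) :
  hausdorff_space X -> hausdorff_space Y -> hausdorff_space (X * Y)%type.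
Proof.
move=> hX hY [x y] [x' y'] xy; congr pair.
- apply: hX => A B Ax Bx.
  have [||[a b] [/= [Aa _] [Ba _]]] := xy (A `*` setT) (B `*` setT).
  + by exists (A, setT) => //; split => //; exact: filterT.
  + by exists (B, setT) => //; split => //; exact: filterT.
  by exists a.
- apply: hY => A B Ay By.
  have [||[a b] [/= [_ Ab] [_ Bb]]] := xy (setT `*` A) (setT `*` B).
  + by exists (setT, A) => //; split => //; exact: filterT.
  + by exists (setT, B) => //; split => //; exact: filterT.
  by exists b.
Qed.

Lemma cvg_row (E : topologicalType) n T (D : set_system T) {FD : Filter D}
    (f : T -> 'I_n -> E) (v : 'rV[E]_n) :
  (forall i, f^~ i @ D --> v 0 i) -> (fun t => \row_i f t i) @ D --> v.
Proof.
move=> fv A [P vP PA].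
apply: (@filterS _ D _ [set t | forall i, P 0 i (f t i)]).
  move=> t tP; apply: PA => i j /=; rewrite mxE (ord1 i); exact: tP.
apply: filter_forall => i; exact: (fv i _ (vP 0 i)).
Qed.

(** * Maps of class $C^k$: derivatives of order one and two *)

Section CkOn.
Variables (R : realType) (E G : tvsType R).
Implicit Types (f g : E -> G) (U : set E).

Lemma C1_on_eq U f g : (forall x, U x -> f x = g x) -> C1_on U f -> C1_on U g.
Proof.
move=> fg [oU fU cf].
have fg_near x : U x -> \forall y \near x, f y = g y.
  by move=> Ux; apply: filterS fg _; exact: open_nbhs_nbhs.
split=> // [x v Ux|z Uz].
  exact: dirderivable_near (fg_near _ Ux) (fU x v Ux).
rewrite /prop_for /continuous_at -(dirderiv_near z.2 (fg_near _ Uz)).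
apply: cvg_trans (cf z Uz); apply: near_eq_cvg.
exists (U, setT) => /=; first by split; [exact: open_nbhs_nbhs|exact: filterT].
by move=> y [/= Uy _]; apply: dirderiv_near; exact: fg_near.
Qed.

Lemma CkOn_eq k U f g : (forall x, U x -> f x = g x) ->
  CkOn k U f -> CkOn k U g.
Proof.
move=> fg [oU fU].
have fg_near (h h' : E -> G) : (forall x, U x -> h x = h' x) ->
    forall x, U x -> \forall y \near x, h y = h' y.
  by move=> hh x Ux; apply: filterS hh _; exact: open_nbhs_nbhs.
have iter_eq vs x : U x -> iter_dirderiv f vs x = iter_dirderiv g vs x.
  elim: vs x => [|v vs IH] x Ux /=; first exact: fg.
  by apply: dirderiv_near; exact: fg_near Ux.
split=> // j jk; have [fd fc] := fU j jk; split=> [vs v a vsj Ua|p Up].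
  apply: dirderivable_near (fd vs v a vsj Ua).
  by apply: fg_near Ua => x; exact: iter_eq.
rewrite /prop_for /continuous_at -iter_eq//.
apply: cvg_trans (fc p Up); apply: near_eq_cvg.
exists (U, setT) => /=; first by split; [exact: open_nbhs_nbhs|exact: filterT].
by move=> q [/= Uq _]; exact: iter_eq.
Qed.

Lemma CkOn_C1 k U f : le_smoothness 1 k -> CkOn k U f -> C1_on U f.
Proof.
move=> k1 [oU /(_ _ k1)[fd fc]]; split=> // [x v Ux|z Uz].
  exact: (fd [::]).
have := fc (z.1, \row_(i < 1) z.2) Uz.
rewrite /prop_for /continuous_at /= enum_ordSl enum_ord0 /= mxE => fcz.
pose r (y : E * E) : E * 'rV[E]_1 := (y.1, \row_(i < 1) y.2).
have rz : r @ z --> (z.1, \row_(i < 1) z.2).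
  have r2 : (fun y : E * E => \row_(i < 1) y.2) @ z --> \row_(i < 1) z.2.
    by apply: cvg_row => i; rewrite mxE; exact: cvg_snd.
  exact: (cvg_pair (G := nbhs z.1) (H := nbhs (\row_(i < 1) z.2)) cvg_fst r2).
have := cvg_comp _ _ rz fcz; apply: cvg_trans; apply: near_eq_cvg.
by apply: filterE => y; rewrite /= mxE.
Qed.

Lemma CkOn_C2 k U f : le_smoothness 2 k -> CkOn k U f ->
  (forall x v w, U x -> dirderivable (fun y => dirderiv f y v) x w) /\
  forall z : E * E * E, U z.1.1 -> {for z, continuous (fun z : E * E * E =>
    dirderiv (fun y => dirderiv f y z.1.2) z.1.1 z.2)}.
Proof.
move=> k2 [oU /(_ _ k2)[fd fc]]; split=> [x v w Ux|z Uz].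
  exact: (fd [:: v]).
(* The head of the list given to [iter_dirderiv] is the direction differentiated last, so index 0
   receives [y.2]. *)
pose vw (y : E * E * E) (i : 'I_2) := if i == ord0 then y.2 else y.1.2.
have := fc (z.1.1, \row_i vw z i) Uz.
rewrite /prop_for /continuous_at /= !enum_ordSl enum_ord0 /= !mxE /= => fcz.
pose r (y : E * E * E) : E * 'rV[E]_2 := (y.1.1, \row_i vw y i).
have rz : r @ z --> (z.1.1, \row_i vw z i).
  have z1 : (fun y : E * E * E => y.1) @ z --> z.1 by exact: cvg_fst.
  have rv : (fun y => \row_i vw y i) @ z --> \row_i vw z i.
    apply: cvg_row => i; rewrite mxE /vw; case: ifP => _; first exact: cvg_snd.
    exact: (cvg_comp _ _ z1 cvg_snd).
  exact: (cvg_pair (G := nbhs z.1.1) (H := nbhs (\row_i vw z i))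
    (cvg_comp _ _ z1 cvg_fst) rv).
have := cvg_comp _ _ rz fcz; apply: cvg_trans; apply: near_eq_cvg.
by apply: filterE => y; rewrite /= !mxE.
Qed.

(** The local form of [tmap f]. *)
Definition tangent_map f (z : E * E) : G * G := (f z.1, dirderiv f z.1 z.2).

(** By linearity of the derivative at [z.1 + t *: w.1], the quotient of the second component is that
    of the derivative in the fixed direction [z.2], plus the derivative at the moving point in
    direction [w.2], which converges by joint continuity. *)
Lemma dquot_tangent_map k U f (z w : E * E) :
  hausdorff_space G -> seminormable E -> seminormable G ->
  le_smoothness 2 k -> CkOn k U f -> U z.1 ->
  dquot (tangent_map f) z w @ 0^' -->
  (dirderiv f z.1 w.1,
   dirderiv (fun y => dirderiv f y z.2) z.1 w.1 + dirderiv f z.1 w.2).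
Proof.
move=> HG hE hG k2 fU Uz.
have k1 : le_smoothness 1 k by case: k k2 {fU} => // k /ltnW.
have f1 := CkOn_C1 k1 fU; have [oU fd fc] := f1; have [fd2 _] := CkOn_C2 k2 fU.
have H1 := cvg_dirderiv (fd _ w.1 Uz).
have H2 := cvg_dirderiv (fd2 _ z.2 w.1 Uz).
have zw := @cvg_line_dnbhs _ _ z.1 w.1.
have H3 : (fun t : R => dirderiv f (z.1 + t *: w.1) w.2) @ 0^' -->
    dirderiv f z.1 w.2.
  have zw2 : (fun t : R => (z.1 + t *: w.1, w.2)) @ 0^' --> (z.1, w.2).
    by apply: cvg_pair => //; exact: cvg_cst.
  exact: cvg_comp zw2 (fc (z.1, w.2) Uz).
have : (fun t : R => (dquot f z.1 w.1 t,
    dquot (fun y => dirderiv f y z.2) z.1 w.1 t +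
    dirderiv f (z.1 + t *: w.1) w.2)) @ 0^' --> (dirderiv f z.1 w.1,
   dirderiv (fun y => dirderiv f y z.2) z.1 w.1 + dirderiv f z.1 w.2).
  by apply: cvg_pair => //; exact: tvs_cvgD.
apply: cvg_trans; apply: near_eq_cvg; near=> t.
have tn : t != 0 by near: t; exact: (@withinT R).
have Ut : U (z.1 + t *: w.1).
  by near: t; apply: zw; exact: open_nbhs_nbhs.
rewrite /dquot /tangent_map; congr pair => /=.
rewrite (dirderivD _ _ HG hE hG f1 Ut) dirderivZ//; last exact: fd.
by rewrite [X in _ = _ *: X]addrAC [RHS]scalerDr scalerA mulVf// scale1r.
Unshelve. all: by end_near. Qed.

Lemma C1_tangent_map k U f :
  hausdorff_space G -> seminormable E -> seminormable G ->
  le_smoothness 2 k -> CkOn k U f -> C1_on [set z | U z.1] (tangent_map f).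
Proof.
move=> HG hE hG k2 fU.
have k1 : le_smoothness 1 k by case: k k2 {fU} => // k /ltnW.
have [oU fd fc] := CkOn_C1 k1 fU; have [fd2 fc2] := CkOn_C2 k2 fU.
have oTU : open [set z : E * E | U z.1].
  apply: open_comp => // z _; exact: cvg_fst.
split=> // [z w Uz|z Uz].
  by eexists; exact: dquot_tangent_map fU Uz.
have TE (y : (E * E) * (E * E)) : U y.1.1 ->
  dirderiv (tangent_map f) y.1 y.2 = (dirderiv f y.1.1 y.2.1,
   dirderiv (fun x => dirderiv f x y.1.2) y.1.1 y.2.1 + dirderiv f y.1.1 y.2.2).
  move=> Uy; apply: dirderiv_unique; first exact: hausdorff_prod.
  exact: dquot_tangent_map fU Uy.
rewrite /prop_for /continuous_at TE//.
have y1 : (fun y : (E * E) * (E * E) => y.1) @ z --> z.1 by exact: cvg_fst.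
have y2 : (fun y : (E * E) * (E * E) => y.2) @ z --> z.2 by exact: cvg_snd.
have y11 : (fun y : (E * E) * (E * E) => y.1.1) @ z --> z.1.1.
  exact: (cvg_comp _ _ y1 cvg_fst).
have y12 : (fun y : (E * E) * (E * E) => y.1.2) @ z --> z.1.2.
  exact: (cvg_comp _ _ y1 cvg_snd).
have y21 : (fun y : (E * E) * (E * E) => y.2.1) @ z --> z.2.1.
  exact: (cvg_comp _ _ y2 cvg_fst).
have y22 : (fun y : (E * E) * (E * E) => y.2.2) @ z --> z.2.2.
  exact: (cvg_comp _ _ y2 cvg_snd).
have : (fun y : (E * E) * (E * E) => (dirderiv f y.1.1 y.2.1,
   dirderiv (fun x => dirderiv f x y.1.2) y.1.1 y.2.1 + dirderiv f y.1.1 y.2.2))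
   @ z --> (dirderiv f z.1.1 z.2.1,
   dirderiv (fun x => dirderiv f x z.1.2) z.1.1 z.2.1 + dirderiv f z.1.1 z.2.2).
  apply: cvg_pair.
    exact: (cvg_comp _ _ (cvg_pair y11 y21) (fc (_, _) Uz)).
  apply: tvs_cvgD.
    exact: (cvg_comp _ _ (cvg_pair (cvg_pair y11 y12) y21) (fc2 (_, _, _) Uz)).
  exact: (cvg_comp _ _ (cvg_pair y11 y22) (fc (_, _) Uz)).
apply: cvg_trans; apply: near_eq_cvg.
have : nbhs z [set y : (E * E) * (E * E) | U y.1.1].
  by apply: y11; exact: open_nbhs_nbhs.
by apply: filterS => y Uy; rewrite TE.
Qed.

End CkOn.

(** * Tangent vectors in charts *)

Section Pullback.
Variables (X Y E : Type).

Definition pullback (c : chart Y E) (f : X -> Y) : chart X E :=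
  Chart (f @^-1` cdom c) (c \o f).

End Pullback.

Lemma pullbackK (X Y E : Type) (c : chart X E) (f : X -> Y) (g : Y -> X) :
  cancel f g -> pullback (pullback c g) f = c.
Proof.
move=> fK; case: c => D c; rewrite /pullback /=; congr Chart.
  by apply/seteqP; split=> x /=; rewrite fK.
by apply/funext => x /=; rewrite fK.
Qed.

Lemma locrepE (R : realType) (E G : tvsType R) (X Y : Type) (c : chart X E)
    (d : chart Y G) (f : X -> Y) x :
  set_inj (cdom c) c -> cdom c x -> cdom d (f x) ->
  locrep c d f (c x) = d (f x).
Proof.
move=> cI cx dfx; rewrite /locrep; set P := (X in xget _ X).
have [z [cz _ czx] <-] : P (xget 0 P) by apply: xgetPex; exists (d (f x)), x.
by rewrite (cI z x)// inE.
Qed.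

Lemma chart_at_atlas (R : realType) (E : tvsType R) (M : chartedSpace E) x :
  atlas M (chart_at x).
Proof. by rewrite /chart_at; case: (cid2 _). Qed.

Lemma chart_at_dom (R : realType) (E : tvsType R) (M : chartedSpace E) (x : M) :
  cdom (chart_at x) x.
Proof. by rewrite /chart_at; case: (cid2 _). Qed.

#[local] Hint Resolve chart_at_atlas chart_at_dom : core.

(** What the calculus of tangent vectors rests on, separated from [Ck_manifold] so that it can be
    verified for [tbundle M] as well as for [M]. *)
Definition C1_atlas (R : realType) (E : tvsType R) (M : chartedSpace E) :=
  [/\ hausdorff_space E, seminormable E,
      forall c, atlas M c -> set_inj (cdom c) c &
      forall c d, atlas M c -> atlas M d ->
        C1_on (locdom c d setT id) (locrep c d id)].

(** Near [c x] the representative into [e] is the one into [d] followed by the change of charts,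
    because both domains are open; the chain rule applies. The set [A] makes room for curves given
    on [I]. *)
Lemma chain_locrep (R : realType) (E G : tvsType R) (X : Type)
    (N : chartedSpace G) (f : X -> N) (A : set X) (c : chart X E)
    (d e : chart N G) x u :
  C1_atlas N -> set_inj (cdom c) c -> atlas N d -> atlas N e ->
  A x -> cdom c x -> cdom d (f x) -> cdom e (f x) ->
  open (locdom c d A f) -> open (locdom c e A f) ->
  dirderivable (locrep c d f) (c x) u ->
  dirderiv (locrep c e f) (c x) u =
  dirderiv (locrep d e id) (d (f x)) (dirderiv (locrep c d f) (c x) u).
Proof.
move=> [HG hG inj trans] cI Nd Ne Ax cx dx ex od oe der.
have dI := inj d Nd.
apply: dirderiv_unique => //.
rewrite -[d (f x)](locrepE cI cx dx).
apply: (@dquot_cvg_near _ _ _ (locrep d e id \o locrep c d f)); last first.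
  apply: C1_comp_cvg (trans d e Nd Ne) _ der => //.
  by rewrite (locrepE cI cx dx); exists (f x).
have nd : nbhs (c x) (locdom c d A f).
  by apply: open_nbhs_nbhs; split=> //; exists x.
have ne : nbhs (c x) (locdom c e A f).
  by apply: open_nbhs_nbhs; split=> //; exists x.
apply: filterS2 nd ne => _ [z [Az cz dz] <-] [z' [Az' cz' ez'] zz'].
have {}zz' : z' = z by apply: cI; rewrite ?inE.
by rewrite /= zz' in ez' *; rewrite !locrepE.
Qed.

Section Tangents.
Variables (R : realType) (E : tvsType R) (M : chartedSpace E).
Hypothesis hM : C1_atlas M.
Implicit Types (x : M) (c d : chart M E) (v w : tangent M).

Lemma chain_id x c d e u : atlas M c -> atlas M d -> atlas M e ->
  cdom c x -> cdom d x -> cdom e x ->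
  dirderiv (locrep c e id) (c x) u =
  dirderiv (locrep d e id) (d x) (dirderiv (locrep c d id) (c x) u).
Proof.
move=> Mc Md Me cx dx ex; have [_ _ inj trans] := hM.
have [od der _] := trans c d Mc Md; have [oe _ _] := trans c e Mc Me.
apply: (chain_locrep (N := M) (f := id) (A := setT)) => //; first exact: inj.
by apply: der; exists x.
Qed.

Lemma tclass_change x c d u : atlas M c -> atlas M d -> cdom c x -> cdom d x ->
  tclass x c u = tclass x d (dirderiv (locrep c d id) (c x) u).
Proof.
move=> Mc Md cx dx; apply/seteqP; split=> -[e w] [/= Me ex ->]; split=> //=.
  exact: chain_id.
by rewrite -chain_id.
Qed.

Lemma trep_tclass v c d u : tvalue v = tclass (tbase v) c u ->
  atlas M d -> cdom d (tbase v) ->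
  trep d v = dirderiv (locrep c d id) (c (tbase v)) u.
Proof.
move=> vE Md dx; rewrite /trep vE; set P := (X in xget _ X).
have [] // : P (xget 0 P).
by apply: (@xgetPex _ 0); exists (dirderiv (locrep c d id) (c (tbase v)) u).
Qed.

Lemma trep_change v c d : atlas M c -> atlas M d ->
  cdom c (tbase v) -> cdom d (tbase v) ->
  trep d v = dirderiv (locrep c d id) (c (tbase v)) (trep c v).
Proof.
move=> Mc Md cx dx; have [e [u [Me ex vE]]] := tvalueP v.
by rewrite (trep_tclass vE Md dx) (trep_tclass vE Mc cx) -chain_id.
Qed.

Lemma tvalue_trep v c : atlas M c -> cdom c (tbase v) ->
  tvalue v = tclass (tbase v) c (trep c v).
Proof.
move=> Mc cx; have [e [u [Me ex vE]]] := tvalueP v.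
by rewrite (trep_tclass vE Mc cx) -tclass_change.
Qed.

(** [tvalue v] contains only charts around the base point, so [xget] returns its default. Identities
    between representations can thus hold on the whole tangent bundle, as equalities of
    functions. *)
Lemma trep_out v c : ~ cdom c (tbase v) -> trep c v = 0.
Proof.
move=> ncx; apply: xgetPN => u /=.
by have [e [w [_ _ ->]]] := tvalueP v => -[].
Qed.

Lemma tangent_eq v w c : atlas M c -> cdom c (tbase v) ->
  tbase v = tbase w -> trep c v = trep c w -> v = w.
Proof.
move=> Mc cv vw cvw; have cw : cdom c (tbase w) by rewrite -vw.
have := tvalue_trep Mc cv; rewrite cvw vw -tvalue_trep// => {cv cw cvw}.
case: v w vw => x a ax [y b bY] /= xy ab.
by move: bY; rewrite -xy -ab => bY; congr Tangent; exact: Prop_irrelevance.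
Qed.

(** The change from [c] to itself is the identity near [c x], so its derivative fixes [u]. *)
Lemma trep_tangent x c u (H : exists d e, [/\ atlas M d, cdom d x &
    tclass x c u = tclass x d e]) : atlas M c -> cdom c x ->
  trep c (Tangent H) = u.
Proof.
move=> Mc cx; rewrite (@trep_tclass (Tangent H) c c u)//=.
have [HE _ inj trans] := hM; have [oc _ _] := trans c c Mc Mc.
apply: dirderiv_unique => //.
apply: (@dquot_cvg_near _ _ _ id).
  have : nbhs (c x) (locdom c c setT id).
    by apply: open_nbhs_nbhs; split => //; exists x.
  by apply: filterS => _ [z [_ cz _] <-]; rewrite locrepE//; exact: inj.
have : (fun _ : R => u) @ 0^' --> u by exact: cvg_cst.
apply: cvg_trans; apply: near_eq_cvg; near=> t.
have tn : t != 0 by near: t; exact: (@withinT R).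
by rewrite /dquot addrC addKr scalerA mulVf// scale1r.
Unshelve. all: by end_near. Qed.

End Tangents.

(** [tmap] is defined through one chosen target chart; [chain_locrep] frees it from that choice. *)
Lemma trep_tmap (R : realType) (E G : tvsType R) (M : chartedSpace E)
    (N : chartedSpace G) (f : M -> N) (A : set M) (v : tangent M)
    (e : chart N G) :
  let x := tbase v in let c := chart_at x in
  C1_atlas N -> set_inj (cdom c) c -> A x ->
  (forall d, atlas N d -> open (locdom c d A f)) ->
  (forall d, atlas N d -> cdom d (f x) ->
    dirderivable (locrep c d f) (c x) (trep c v)) ->
  atlas N e -> cdom e (f x) ->
  trep e (tmap f v) = dirderiv (locrep c e f) (c x) (trep c v).
Proof.
move=> x c hN cI Ax of_ df Ne ex; have cx : cdom c x by exact: chart_at_dom.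
rewrite (@trep_tclass _ _ _ (tmap f v) (chart_at (f x)) e
  (dirderiv (locrep c (chart_at (f x)) f) (c x) (trep c v)))//.
rewrite (chain_locrep (d := chart_at (f x)) hN cI _ Ne Ax)//.
- exact: of_.
- exact: of_.
- exact: df.
Qed.

(** * The atlas of the tangent bundle *)

Section TangentBundleAtlas.
Variables (R : realType) (E : tvsType R) (M : chartedSpace E) (k : smoothness).

Lemma C1_atlas_Ck : le_smoothness 1 k -> hausdorff_space E -> seminormable E ->
  Ck_manifold k M -> C1_atlas M.
Proof.
move=> k1 HE hE [_ homeo compat _]; split=> // [c /homeo[]//|c d Mc Md].
by apply: CkOn_C1 k1 _; have [] := compat c d Mc Md.
Qed.

(** The changes of charts of the tangent bundle are given by [tangent_map] of those of [M], hence
    are $C^1$ when the latter are $C^2$. *)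
Lemma C1_atlas_tbundle : le_smoothness 2 k -> hausdorff_space E ->
  seminormable E -> Ck_manifold k M -> C1_atlas (tbundle M).
Proof.
move=> k2 HE hE mM; have [_ _ compat _] := mM.
have k1 : le_smoothness 1 k by case: k k2 {mM compat} => // j /ltnW.
have hM := C1_atlas_Ck k1 HE hE mM; have [_ _ inj _] := hM.
have tinj c : atlas M c -> set_inj (cdom (tchart c)) (tchart c).
  move=> Mc v w; rewrite !inE /= => cv cw [cvw].
  by apply: (tangent_eq hM Mc cv); apply: (inj c Mc); rewrite ?inE.
split; [exact: hausdorff_prod|exact: seminormable_prod| |].
  by move=> _ [c Mc <-]; exact: tinj.
move=> _ _ [c Mc <-] [d Md <-]; have [cd _] := compat c d Mc Md.
(* Every pair [(c x, u)] comes from a tangent vector, so only the first component restricts the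
   domain. *)
have -> : locdom (tchart c) (tchart d) setT id =
    [set z : E * E | locdom c d setT id z.1].
  apply/seteqP; split=> [_ [v [_ cv dv] <-]|[y u] /= [x [_ cx dx] <-]] /=.
    by exists (tbase v).
  have H : exists d e, [/\ atlas M d, cdom d x & tclass x c u = tclass x d e].
    by exists c, u.
  by exists (Tangent H) => //=; rewrite trep_tangent.
apply: C1_on_eq (C1_tangent_map HE hE hE k2 cd) => -[y u] /= [x [_ cx dx] <-].
have H : exists d e, [/\ atlas M d, cdom d x & tclass x c u = tclass x d e].
  by exists c, u.
have -> : (c x, u) = tchart c (Tangent H) by rewrite /= trep_tangent.
rewrite locrepE//; last exact: tinj.
rewrite /tangent_map /= locrepE//; last exact: inj.
by rewrite -(trep_change hM (v := Tangent H)).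
Qed.

End TangentBundleAtlas.

(** A diffeomorphism seen through its action on charts, a form that passes from [phi] to
    [tmap phi]. *)
Definition atlas_automorphism (R : realType) (E : tvsType R)
    (M : chartedSpace E) (phi psi : M -> M) : Prop :=
  [/\ cancel phi psi, cancel psi phi,
      forall c, atlas M c -> atlas M (pullback c phi) &
      forall c, atlas M c -> atlas M (pullback c psi)].

Lemma atlas_automorphism_sym (R : realType) (E : tvsType R)
    (M : chartedSpace E) (phi psi : M -> M) :
  atlas_automorphism phi psi -> atlas_automorphism psi phi.
Proof. by case. Qed.

(* The transition maps between [pullback c phi] and a chart [d] are the local
   representatives of [psi] and [phi] in [c] and [d], so the pulled back chart
   belongs to the maximal atlas. *)
Lemma Ck_diffeo_atlas (R : realType) (E : tvsType R) (M : chartedSpace E) k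
    (phi psi : M -> M) : Ck_manifold k M -> cancel phi psi -> cancel psi phi ->
  Ck_map k phi -> Ck_map k psi -> atlas_automorphism phi psi.
Proof.
move=> mM.
suff pb (f g : M -> M) c : cancel f g -> cancel g f -> Ck_map k f ->
    Ck_map k g -> atlas M c -> atlas M (pullback c f).
  by move=> ? ? ? ?; split=> // c; apply: pb.
move=> fK gK [fc fk] [gc gk] Mc; have [_ homeo _ maxi] := mM.
have [oc cI cc co] := homeo c Mc.
(* Images under [f] are preimages under [g], so continuity of [g] makes [f] open. *)
have img (A : set M) : f @` A = g @^-1` A.
  apply/seteqP; split=> [_ [x Ax <-]|y Ay] /=; first by rewrite fK.
  by exists (g y).
have cf : continuous f by move=> x; exact: fc.
have cg : continuous g by move=> x; exact: gc.
apply: maxi => [|d Md].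
  split.
  - by apply: open_comp => // x _; exact: cf.
  - move=> x y; rewrite !inE /= => cx cy cxy.
    by apply: (can_inj fK); apply: cI; rewrite ?inE.
  - by move=> x cx; apply: continuous_comp; [exact: cf|exact: cc].
  - move=> A Ac oA.
    have -> : pullback c f @` A = c @` (f @` A) by rewrite image_comp.
    apply: co; first by move=> _ [x Ax <-]; exact: Ac.
    by rewrite img; apply: open_comp => // x _; exact: cg.
split; last exact: (fk d c).
have -> : locdom (pullback c f) d setT id = locdom c d setT g.
  apply/seteqP; split=> [_ [x [_ cx dx] <-]|_ [x [_ cx dx] <-]] /=.
    by exists (f x) => //; rewrite /= fK.
  by exists (g x) => //=; rewrite gK.
have -> : locrep (pullback c f) d id = locrep c d g; last exact: gk.
apply/funext => y; rewrite /locrep; congr xget; apply/seteqP.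
split=> [_ [x [/= cx dx xy] <-]|_ [x [/= cx dx xy] <-]] /=.
  by exists (f x); rewrite /= ?fK.
by exists (g x); rewrite /= ?gK.
Qed.

(** * Tangent maps of automorphisms *)

Section Automorphisms.
Variables (R : realType) (E : tvsType R) (M : chartedSpace E).
Hypothesis hM : C1_atlas M.
Variables phi psi : M -> M.
Hypothesis aut : atlas_automorphism phi psi.

(** The representative of [phi] from a chart [d] to [c] is by definition the change of charts from
    [d] to [pullback c phi], so the claim becomes [trep_change]. Outside the domain both sides are
    0. *)
Lemma trep_pullback (c : chart M E) (v : tangent M) : atlas M c ->
  trep c (tmap phi v) = trep (pullback c phi) v.
Proof.
move=> Mc; have [phiK _ pb _] := aut; have [_ _ inj trans] := hM.
have [cx|ncx] := pselect (cdom c (phi (tbase v))); last by rewrite !trep_out.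
rewrite (@trep_tmap _ _ _ _ _ phi setT v c)//.
- by rewrite [RHS](trep_change hM (c := chart_at (tbase v)))//; exact: pb.
- exact: inj.
- move=> d Md.
  by have [] := trans (chart_at (tbase v)) _ (chart_at_atlas _) (pb d Md).
- move=> d Md dx.
  have [_ + _] := trans (chart_at (tbase v)) _ (chart_at_atlas _) (pb d Md).
  by apply; exists (tbase v).
Qed.

(** Equality of the charts themselves lets the results on [phi] be repeated for [tmap phi], one
    tangent level higher. *)
Lemma pullback_tchart (c : chart M E) : atlas M c ->
  pullback (tchart c) (tmap phi) = tchart (pullback c phi).
Proof.
move=> Mc; rewrite /pullback /tchart /=; congr Chart.
by apply/funext => v /=; rewrite trep_pullback.
Qed.

End Automorphisms.

Section TangentAutomorphisms.
Variables (R : realType) (E : tvsType R) (M : chartedSpace E).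
Hypothesis hM : C1_atlas M.

Lemma tmapK (phi psi : M -> M) :
  atlas_automorphism phi psi -> cancel (tmap phi) (tmap psi).
Proof.
move=> aut v; have [phiK psiK _ pb'] := aut.
have aut' := atlas_automorphism_sym aut.
have b : tbase (tmap psi (tmap phi v)) = tbase v by rewrite /= phiK.
apply: (tangent_eq hM (c := chart_at (tbase v))) => //; first by rewrite b.
rewrite (trep_pullback hM aut')// (trep_pullback hM aut) ?pullbackK//.
exact: pb'.
Qed.

Lemma atlas_automorphism_tmap (phi psi : M -> M) :
  atlas_automorphism phi psi ->
  atlas_automorphism (M := tbundle M) (tmap phi) (tmap psi).
Proof.
move=> aut; have aut' := atlas_automorphism_sym aut; have [_ _ pb pb'] := aut.
split; [exact: tmapK|exact: tmapK| |].
  move=> _ [c Mc <-]; exists (pullback c phi); first exact: pb.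
  by rewrite (pullback_tchart hM aut).
move=> _ [c Mc <-]; exists (pullback c psi); first exact: pb'.
by rewrite (pullback_tchart hM aut').
Qed.

(** Openness is tested in charts, and [tchart (pullback c psi)] at [tmap phi v] has the value of
    [tchart c] at [v]; the test for [A] becomes that for its preimage. *)
Lemma tmap_continuous (phi psi : M -> M) :
  atlas_automorphism phi psi -> continuous (tmap phi : tbundle M -> tbundle M).
Proof.
move=> aut; have [phiK psiK _ pb'] := aut.
apply/continuousP => A oA; suff : topen (tmap phi @^-1` A) by [].
move=> c Mc v Av cv; have {}oA : topen A := oA.
have tE (u : tangent M) : tchart (pullback c psi) (tmap phi u) = tchart c u.
  rewrite -[in RHS](pullbackK c phiK) -(pullback_tchart hM aut)//.
  exact: pb'.
have cv' : cdom (tchart (pullback c psi)) (tmap phi v) by rewrite /= phiK.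
have := oA _ (pb' c Mc) _ Av cv'; rewrite tE.
apply: filterS => p pA u cu up; apply: pA; last by rewrite tE.
by rewrite /= phiK.
Qed.

End TangentAutomorphisms.

(** * Transport of geodesics and adjacent cones *)

Section Maps.
Variables (R : realType) (E G : tvsType R).
Variables (M : chartedSpace E) (N : chartedSpace G).

Lemma Ck_map_on_eq k (A : set M) (f g : M -> N) :
  (forall c, atlas M c -> set_inj (cdom c) c) -> open A ->
  (forall x, A x -> f x = g x) -> Ck_map_on k A f -> Ck_map_on k A g.
Proof.
move=> inj oA fg [fc fk]; split=> [x Ax|c d Mc Nd].
  rewrite /prop_for /continuous_at -fg//; apply: cvg_trans (fc x Ax).
  by apply: near_eq_cvg; apply: filterS fg _; exact: open_nbhs_nbhs.
have -> : locdom c d A g = locdom c d A f.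
  by apply/seteqP; split=> _ [x [Ax cx dx] <-]; exists x => //; split=> //;
    rewrite ?fg// -fg.
apply: CkOn_eq (fk c d Mc Nd) => _ [x [Ax cx dfx] <-].
by rewrite !locrepE -?fg//; exact: inj.
Qed.

(** The representative of [phi \o f] in [d] is that of [f] in [pullback d phi], so no chain rule is
    involved. *)
Lemma Ck_map_on_comp k (A : set M) (f : M -> N) (phi : N -> N) :
  continuous phi -> (forall c, atlas N c -> atlas N (pullback c phi)) ->
  Ck_map_on k A f -> Ck_map_on k A (phi \o f).
Proof.
move=> cphi pb [fc fk]; split=> [x Ax|c d Mc Nd].
  by apply: continuous_comp; [exact: fc|exact: cphi].
exact: (fk c (pullback d phi) Mc (pb d Nd)).
Qed.

End Maps.

Lemma line_chart_inj (R : realType) (c : chart (line R) R^o) :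
  atlas (line R) c -> set_inj (cdom c) c.
Proof. by move=> ->. Qed.

Section Curves.
Variables (R : realType) (E : tvsType R) (N : chartedSpace E).
Hypothesis hN : C1_atlas N.
Variable I : set R.
Hypothesis oI : open I.
Local Notation Ck_curve :=
  (Ck_map_on (M := line R) (N := N) (Some 1%N) (I : set (line R))).

Lemma trep_clift (g : line R -> N) (t : R) (d : chart N E) :
  Ck_curve g -> I t ->
  atlas N d -> cdom d (g t) ->
  let c := chart_at (t : line R) in
  trep d (clift g t) =
  dirderiv (locrep c d g) (c t) (trep c (@tvec R R^o (line R) t 1)).
Proof.
move=> [_ gk] It Nd dt c; have ct : cdom c t by exact: chart_at_dom.
apply: (@trep_tmap _ _ _ (line R) N g I (@tvec R R^o (line R) t 1)) => //.
- exact: line_chart_inj.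
- by move=> e Ne; have [] := gk c e (chart_at_atlas _) Ne.
- move=> e Ne et.
  have /(CkOn_C1 (k := Some 1%N) isT)[_ + _] := gk c e (chart_at_atlas _) Ne.
  by apply; exists t.
Qed.

(** As [I] is open, the representatives of both curves agree near [t]. This serves to compare second
    lifts of curves whose first lifts are known on [I] only. *)
Lemma clift_eq (f g : line R -> N) (t : R) : Ck_curve f ->
  (forall s, I s -> f s = g s) -> I t -> clift f t = clift g t.
Proof.
move=> Cf fg It.
have Cg : Ck_curve g := Ck_map_on_eq (M := line R) (@line_chart_inj R) oI fg Cf.
have b : tbase (clift f t) = tbase (clift g t) by exact: fg.
have ft : cdom (chart_at (f t)) (f t) by [].
apply: (tangent_eq hN (c := chart_at (f t))) => //.
rewrite !trep_clift -?fg//; apply: dirderiv_near.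
have [_ fk] := Cf; pose c := chart_at (t : line R).
have ct : cdom c t by exact: chart_at_dom.
have [od _] := fk c _ (chart_at_atlas _) (chart_at_atlas (f t)).
have : nbhs (c t) (locdom c (chart_at (f t)) I f).
  by apply: open_nbhs_nbhs; split=> //; exists t.
apply: filterS => _ [s [Is cs ds] <-].
have inj := line_chart_inj (chart_at_atlas (t : line R)).
by rewrite !locrepE -?fg.
Qed.

(** In a chart [d] at [phi (g t)] both vectors are the same derivative, since [phi \o g] seen in [d]
    is [g] seen in [pullback d phi]. *)
Lemma clift_comp (phi psi : N -> N) (g : line R -> N) (t : R) :
  atlas_automorphism phi psi -> Ck_curve g -> Ck_curve (phi \o g) -> I t ->
  clift (phi \o g) t = tmap phi (clift g t).
Proof.
move=> aut Cg Cpg It; have [_ _ pb _] := aut.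
have pt : cdom (chart_at (phi (g t))) (phi (g t)) by [].
apply: (tangent_eq hN (c := chart_at (phi (g t)))); [by []|by []|by []|].
rewrite (trep_pullback hN aut)// trep_clift// trep_clift//.
exact: pb.
Qed.

End Curves.

Section Sprays.
Variables (R : realType) (E : tvsType R) (M : chartedSpace E).
Hypotheses (hM : C1_atlas M) (hTM : C1_atlas (tbundle M)).
Variables (phi psi : M -> M) (Sp : tbundle M -> tbundle (tbundle M)).
Hypothesis aut : atlas_automorphism phi psi.
Hypothesis phi_cont : continuous phi.
Hypothesis Sp_phi : forall v, Sp (tmap phi v) = tmap (tmap phi) (Sp v).

Lemma clift_geodesic (I : set R) (g : R -> M) (t : R) : open I -> I t ->
  geodesic Sp I g ->
  clift (phi \o g : line R -> M) t = tmap phi (clift (g : line R -> M) t).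
Proof.
move=> oI It [Cg _]; have [_ _ pb _] := aut.
apply: (clift_comp hM (I := I) aut) => //.
exact: Ck_map_on_comp.
Qed.

(** On [I], $(\phi g)''=\phi_{**}g''=\phi_{**}\mathcal S(g')=\mathcal S(\phi_*g')=\mathcal S((\phi
    g)')$. *)
Lemma geodesic_comp (I : set R) (g : R -> M) : open I ->
  geodesic Sp I g -> geodesic Sp I (phi \o g).
Proof.
move=> oI geo; have [Cg [Cg' gS]] := geo; have [_ _ pb _] := aut.
have aut2 := atlas_automorphism_tmap hM aut; have [_ _ pb2 _] := aut2.
have Ctg : Ck_map_on (M := line R) (Some 1%N) (I : set (line R))
    (tmap phi \o clift (g : line R -> M)).
  by apply: Ck_map_on_comp => //; exact: (tmap_continuous hM aut).
have lift t : I t -> (tmap phi \o clift (g : line R -> M)) t =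
    clift (phi \o g : line R -> M) t.
  by move=> It; rewrite /= (clift_geodesic oI It geo).
split; first exact: Ck_map_on_comp.
split=> [|t It].
  exact: (Ck_map_on_eq (M := line R) (@line_chart_inj R) oI lift Ctg).
rewrite -(clift_eq hTM oI Ctg lift It) (clift_comp hTM aut2 Cg' Ctg It) gS//.
by rewrite -Sp_phi (clift_geodesic oI It geo).
Qed.

End Sprays.

(** * Adjacent cones and admissible vectors *)

Section Admissible.
Variables (R : realType) (F : frechetSpace R) (M : chartedSpace F).
Hypotheses (hM : C1_atlas M) (hTM : C1_atlas (tbundle M)).
Variables (phi psi : M -> M).
Hypothesis aut : atlas_automorphism phi psi.

Lemma chart_image_pullback (c : chart M F) (S : set M) :
  pullback c psi @` (cdom (pullback c psi) `&` phi @` S) =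
  c @` (cdom c `&` S).
Proof.
have [phiK _ _ _] := aut; apply/seteqP; split=> [_ [y [/= cy [x Sx xy]] <-]|].
  by move: cy; rewrite -xy phiK => cx; exists x.
move=> _ [x [cx Sx] <-]; exists (phi x); rewrite /= ?phiK//.
by split=> //; exists x.
Qed.

Lemma trep_tmap_pullback (c : chart M F) (v : tangent M) : atlas M c ->
  trep (pullback c psi) (tmap phi v) = trep c v.
Proof.
move=> Mc; have [phiK _ _ pb'] := aut.
by rewrite (trep_pullback hM aut) ?pullbackK//; exact: pb'.
Qed.

Lemma adjacent_cone_image (S : set M) s v :
  adjacent_cone S s v -> adjacent_cone (phi @` S) (phi s) (tmap phi v).
Proof.
have [phiK _ _ pb'] := aut.
move=> [<- [c [Mc cs lim]]]; split=> //; exists (pullback c psi); split.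
- exact: pb'.
- by rewrite /= phiK.
- move=> n; rewrite chart_image_pullback trep_tmap_pullback//= phiK.
  exact: lim.
Qed.

Lemma adjacent_cone2_image (S : set M) s (w : tbundle (tbundle M)) :
  adjacent_cone2 S s w ->
  adjacent_cone2 (phi @` S) (phi s) (tmap (tmap phi) w).
Proof.
have [phiK _ _ pb'] := aut; have aut' := atlas_automorphism_sym aut.
have aut2 := atlas_automorphism_tmap hM aut; have [tphiK _ _ tpb'] := aut2.
move=> [cone [c [Mc cs w1 lim]]]; split; first exact: adjacent_cone_image.
(* Pulling [tchart (pullback c psi)] back along [tmap phi] gives [tchart c], so both components of
   [w] are kept. *)
have cw : trep (M := tbundle M) (tchart (pullback c psi)) (tmap (tmap phi) w) =
    trep (M := tbundle M) (tchart c) w.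
  rewrite -(pullback_tchart hM aut')// (trep_pullback hTM aut2) ?pullbackK//.
  by apply: tpb'; exists c.
exists (pullback c psi); split.
- exact: pb'.
- by rewrite /= phiK.
- by rewrite cw w1 -[LHS]trep_tmap_pullback.
- move=> n; rewrite chart_image_pullback cw.
  by rewrite [tproj _]/= trep_tmap_pullback//= phiK; exact: lim.
Qed.

Lemma admissible_image (Sp : tbundle M -> tbundle (tbundle M)) (S : set M) v :
  (forall v, Sp (tmap phi v) = tmap (tmap phi) (Sp v)) ->
  admissible Sp S v -> admissible Sp (phi @` S) (tmap phi v).
Proof.
move=> Sp_phi [Sv cone]; split; first by exists (tproj v).
by rewrite Sp_phi; exact: adjacent_cone2_image.
Qed.

End Admissible.

Theorem theorem2p26 (R : realType) (F : frechetSpace R) (M : chartedSpace F)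
  (k : smoothness) (r : nat) (Sp : tbundle M -> tbundle (tbundle M))
  (S : set M) (phi : M -> M) :
  le_smoothness 4 k ->
  Ck_manifold k M ->
  (2 <= r)%N -> le_smoothness r.+2 k ->
  spray r Sp ->
  S !=set0 ->
  closed S ->
  spray_invariant Sp S ->
  spray_automorphism k Sp phi ->
  spray_invariant Sp (phi @` S).
Proof.
move=> k4 mM _ _ _ _ _ [[v adm] inv] [[Cphi [psi [phiK psiK Cpsi]]]].
move=> [phi_inv [tphiK _ SpE]].
have k2 : le_smoothness 2 k by case: k k4 {mM Cphi Cpsi} => // k /= /ltnW/ltnW.
have k1 : le_smoothness 1 k by case: k k2 {k4 mM Cphi Cpsi} => // k /= /ltnW.
have HF := @frechet_hausdorff R F; have hF := @seminormable_frechet R F.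
have hM := C1_atlas_Ck k1 HF hF mM; have hTM := C1_atlas_tbundle k2 HF hF mM.
have aut := Ck_diffeo_atlas mM phiK psiK Cphi Cpsi.
have aut' := atlas_automorphism_sym aut.
(* The automorphism identity at [tmap phi u], where [phi_inv] cancels. *)
have Sp_phi u : Sp (tmap phi u) = tmap (tmap phi) (Sp u).
  by rewrite -{1}SpE /= tphiK.
have Sp_psi u : Sp (tmap psi u) = tmap (tmap psi) (Sp u).
  rewrite -[u in RHS](tmapK hM aut') Sp_phi.
  by rewrite (tmapK hTM (atlas_automorphism_tmap hM aut)).
split; first by exists (tmap phi v); exact: (admissible_image hM hTM aut).
move=> I g oI iI I0 geo [x0 Sx0 gx0] gadm t It.
have psi_cont : continuous psi by move=> x; case: Cpsi => + _; apply.
have psiS : psi @` (phi @` S) = S.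
  rewrite image_comp -[RHS]image_id; apply: eq_imagel => x _ /=.
  exact: phiK.
(* Invariance of [S] along [psi \o g] puts [psi (g t)] in [S], and [phi] brings it back to [g t]. *)
exists (psi (g t)); last exact: psiK.
apply: (inv I (psi \o g) oI iI I0 _ _ _ t It).
- exact: (geodesic_comp hM hTM aut' psi_cont Sp_psi oI geo).
- by rewrite /= -gx0 phiK.
(* With [S] written as the image under [psi] of its image under [phi], admissibility is carried back
   by [psi]. *)
- rewrite (clift_geodesic hM aut' psi_cont oI I0 geo) -[S]psiS.
  exact: (admissible_image hM hTM aut').
Qed.
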